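(* For every integer $m \geq 1$ and every integer $l$ with $0 \leq l \leq m$, \[ \nu_{2}(A_{l,m}) = \nu_{2}\big((m+1-l)_{2l}\big) + l, \] where $(a)_{k} = a(a+1)\cdots(a+k-1)$ is the Pochhammer symbol (with $(a)_0=1$).
   Context: For integers $m \geq 1$ and $0 \leq l \leq m$ define \[ A_{l,m} = \frac{l!\, m!}{2^{m-l}} \sum_{k=l}^{m} 2^{k} \binom{2m-2k}{m-k}\binom{m+k}{m}\binom{k}{l}. \] These numbers are integers. For a nonzero integer $x$, $\nu_2(x)$ denotes the $2$-adic valuation of $x$, i.e. the exponent of the highest power of $2$ dividing $x$. *)

(* Defs.v *)
From mathcomp Require Import all_boot all_order all_algebra zify ring.
Import GRing.Theory Num.Theory.
Set Implicit Arguments.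
Unset Strict Implicit.
Unset Printing Implicit Defensive.

Definition pochhammer (a k : nat) : nat := \prod_(i < k) (a + i).

Definition A_numer (l m : nat) : nat :=
  l`! * m`! * \sum_(l <= k < m.+1)
    2 ^ k * 'C(2 * m - 2 * k, m - k) * 'C(m + k, m) * 'C(k, l).

(* The division is exact: see dvdn_A_numer and A_ratE below. *)
Definition A (l m : nat) : nat := A_numer l m %/ 2 ^ (m - l).

Lemma dvdn_fact2_fact (j : nat) : 2 ^ j * j`! %| (2 * j)`!.
Proof.
elim: j => [|j IHj] //.
rewrite (_ : 2 * j.+1 = (2 * j).+2); last by lia.
rewrite !factS expnS.
rewrite (_ : 2 * 2 ^ j * (j.+1 * j`!) = (2 * j).+2 * (2 ^ j * j`!)); last by nia.
by rewrite dvdn_mul // dvdn_mull.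
Qed.

Lemma dvdn_A_term (l m k : nat) : l <= k <= m ->
  2 ^ m %| l`! * m`! * ('C(2 * m - 2 * k, m - k) * 'C(m + k, m) * 'C(k, l)).
Proof.
move=> /andP[lk km]; set j := m - k.
have -> : 2 * m - 2 * k = 2 * j by rewrite /j; lia.
have [c Hc] : exists c, 'C(2 * j, j) * j`! = c * 2 ^ j.
  have /dvdnP[c Hc] := dvdn_fact2_fact j; exists c.
  have := @bin_fact (2 * j) j; rewrite (_ : 2 * j - j = j); last by lia.
  move=> /(_ _) Hb; apply/eqP; rewrite -(eqn_pmul2r (fact_gt0 j)).
  by rewrite -!mulnA -Hc Hb //; lia.
have /dvdnP[d Hd] := dvdn_fact2_fact k.
have H1 : 'C(m + k, m) * (m`! * k`!) = (m + k)`!.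
  by have := @bin_fact (m + k) m (leq_addr _ _); rewrite addKn.
have H2 : 'C(m + k, j) * (j`! * (2 * k)`!) = (m + k)`!.
  rewrite -(@bin_fact (m + k) j); last by rewrite /j; lia.
  by congr (_ * (_ * _`!)); rewrite /j; lia.
have H3 : m`! * 'C(m + k, m) = 'C(m + k, j) * j`! * d * 2 ^ k.
  apply/eqP; rewrite -(eqn_pmul2r (fact_gt0 k)); apply/eqP.
  by rewrite (mulnC m`!) -mulnA H1 -H2 Hd !mulnA.
have -> : l`! * m`! * ('C(2 * j, j) * 'C(m + k, m) * 'C(k, l)) =
    l`! * 'C(k, l) * 'C(2 * j, j) * (m`! * 'C(m + k, m)) by ring.
rewrite H3.
have -> : l`! * 'C(k, l) * 'C(2 * j, j) * ('C(m + k, j) * j`! * d * 2 ^ k) =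
    l`! * 'C(k, l) * 'C(m + k, j) * d * ('C(2 * j, j) * j`!) * 2 ^ k by ring.
rewrite Hc -!mulnA -expnD (_ : j + k = m); last by rewrite /j; lia.
by rewrite !mulnA dvdn_mull.
Qed.

Lemma dvdn_A_numer (l m : nat) : 2 ^ (m - l) %| A_numer l m.
Proof.
rewrite /A_numer big_distrr /= big_seq.
apply: dvdn_sum => k; rewrite mem_index_iota ltnS => /dvdn_A_term H.
apply: (@dvdn_trans (2 ^ m)); first by rewrite dvdn_exp2l // leq_subr.
rewrite -!(mulnA (2 ^ k)) (mulnCA _ (2 ^ k)).
exact: dvdn_mull.
Qed.

Lemma A_gt0 (l m : nat) : l <= m -> 0 < A l m.
Proof.
move=> lm; rewrite divn_gt0 ?expn_gt0 //; apply: dvdn_leq; last exact: dvdn_A_numer.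
rewrite /A_numer !muln_gt0 !fact_gt0 /= big_nat_recr //= !subnn bin0.
by rewrite addn_gt0 !muln_gt0 expn_gt0 !bin_gt0 leq_addr lm orbT.
Qed.

Lemma A_ratE (l m : nat) :
  ((A l m)%:R = (l`!)%:R * (m`!)%:R / 2%:R ^+ (m - l) *
    \sum_(l <= k < m.+1) 2%:R ^+ k * ('C(2 * m - 2 * k, m - k))%:R *
      ('C(m + k, m))%:R * ('C(k, l))%:R :> rat)%R.
Proof.
have nz : (2%:R ^+ (m - l) != 0 :> rat)%R by rewrite expf_neq0.
have hA : A l m * 2 ^ (m - l) = A_numer l m by rewrite divnK ?dvdn_A_numer.
apply: (mulIf nz); rewrite -{1}natrX -[LHS]natrM hA mulrAC divfK //.
rewrite /A_numer !natrM natr_sum; congr (_ * _)%R.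
by apply: eq_bigr => k _; rewrite !natrM natrX.
Qed.

(* Main.v *)
Require Import Defs.
From mathcomp Require Import all_boot.
From mathcomp Require Import zify ring.

Set Implicit Arguments.
Unset Strict Implicit.
Unset Printing Implicit Defensive.

(** Put S_l = \sum_k t_k C(k,l), where t_k = 2^k C(2m-2k,m-k) C(m+k,m). The
    first-order recurrence (2m-2k-1)(k+1) t_{k+1} = (m-k)(m+k+1) t_k gives, by
    creative telescoping,
      (m-l)(m+l+1) S_l + (l+1)(l+2) S_{l+2} = (2m+1)(l+1) S_{l+1}.
    Hence b_l := l! m! (m-l)! S_l / (2^m (m+l)!) = A_{l,m} / (2^l (m+1-l)_{2l})
    satisfies
      b_l = (2m+1) b_{l+1} - (m-l-1)(m+l+2) b_{l+2},    b_m = 1.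
    As (m-l-1) + (m+l+2) is odd, the coefficient of b_{l+2} is even, so by
    descending induction every b_l is an odd integer. *)

Definition A_weight (m k : nat) : nat :=
  2 ^ k * 'C(2 * m - 2 * k, m - k) * 'C(m + k, m).

(** This is S_l, with t_k = [A_weight m k]. Summing from 0 keeps the range independent of l, so that
    S_l, S_{l+1}, S_{l+2} combine termwise; the terms with k < l vanish. *)
Definition A_sum (m l : nat) : nat := \sum_(k < m.+1) A_weight m k * 'C(k, l).

Lemma central_binS d : d.+1 * 'C(2 * d.+1, d.+1) = 2 * (2 * d).+1 * 'C(2 * d, d).
Proof.
have h1 := mul_bin_diag (2 * d).+2 d.
have h2 := mul_bin_down (2 * d).+1 d.
rewrite /= in h1 h2.
rewrite (_ : (2 * d).+1 - d = d.+1) in h2; last by lia.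
rewrite (_ : 2 * d.+1 = (2 * d).+2); last by lia.
by rewrite -h1 -mulnA h2; ring.
Qed.

(** Writing m = k+d+1 avoids truncated subtraction. *)
Lemma A_weightS d k :
  (2 * d).+1 * k.+1 * A_weight (k + d.+1) k.+1 =
  d.+1 * (k + d.+1 + k).+1 * A_weight (k + d.+1) k.
Proof.
rewrite /A_weight.
have -> : 2 * (k + d.+1) - 2 * k.+1 = 2 * d by lia.
have -> : k + d.+1 - k.+1 = d by lia.
have -> : 2 * (k + d.+1) - 2 * k = 2 * d.+1 by lia.
have -> : k + d.+1 - k = d.+1 by lia.
set m := k + d.+1.
have h1 : k.+1 * 'C(m + k.+1, m) = (m + k).+1 * 'C(m + k, m).
  rewrite addnS; have := mul_bin_down (m + k).+1 m.
  by rewrite /= (_ : (m + k).+1 - m = k.+1) => [->|]; last by lia.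
have h2 := central_binS d.
transitivity (2 ^ k * (2 * (2 * d).+1 * 'C(2 * d, d)) * (k.+1 * 'C(m + k.+1, m))).
  by rewrite expnS; ring.
by rewrite h1 -h2; ring.
Qed.

(** Put G_k = t_k (2(m-k)+1)(j+1) C(k,j+1). For k < m, [A_weightS] gives G_{k+1} = t_k (m-k)(m+k+1)
    C(k,j), so after multiplication by t_k the two terms beyond the recurrence are G_k on the left
    and G_{k+1} on the right. *)
Lemma A_term_telescope m j k : j <= m -> k <= m ->
  (m - j) * (m + j).+1 * 'C(k, j) + j.+1 * j.+2 * 'C(k, j.+2)
    + (2 * (m - k)).+1 * j.+1 * 'C(k, j.+1) =
  (2 * m).+1 * j.+1 * 'C(k, j.+1) + (m - k) * (m + k).+1 * 'C(k, j).
Proof.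
move=> jm km; have [kj|jk] := ltnP k j.
  by rewrite !bin_small ?muln0 //; lia.
have h1 := mul_bin_left k j.
have h2 : j.+2 * 'C(k, j.+2) + 'C(k, j.+1) = (k - j) * 'C(k, j.+1).
  rewrite mul_bin_left -mulSnr.
  (* For k = j the subtraction k-(j+1) truncates, but then C(k,j+1) = 0. *)
  by have [<-|] := eqVneq j k; [rewrite subnn bin_small ?muln0 | move=> ?; congr (_ * _); lia].
have [i def_k] : exists i, k = j + i by exists (k - j); lia.
have [e def_m] : exists e, m = k + e by exists (m - k); lia.
have ki : k - j = i by lia.
have me : m - k = e by lia.
have mj : m - j = i + e by lia.
rewrite ki in h1 h2; rewrite me mj def_m.
(* The added term completes the left side of [h2]. *)
apply: (@addIn (j.+1 * 'C(k, j.+1))).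
transitivity ((i + e) * (k + e + j).+1 * 'C(k, j)
   + j.+1 * (j.+2 * 'C(k, j.+2) + 'C(k, j.+1)) + (2 * e).+1 * (j.+1 * 'C(k, j.+1))).
  by ring.
rewrite h2 (_ : j.+1 * (i * 'C(k, j.+1)) = i * (j.+1 * 'C(k, j.+1))); last by ring.
rewrite -!(mulnA _ j.+1) h1 def_k; ring.
Qed.

(** The G_k telescope from G_0 = 0 to G_n. The bound n <= m matters: at n = m+1 the factor 2(m-n)+1
    would truncate to 1 instead of -1. *)
Lemma A_partial_sum_rec m j n : j <= m -> n <= m ->
  \sum_(k < n) A_weight m k *
     ((m - j) * (m + j).+1 * 'C(k, j) + j.+1 * j.+2 * 'C(k, j.+2)) =
  \sum_(k < n) A_weight m k * ((2 * m).+1 * j.+1 * 'C(k, j.+1))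
    + A_weight m n * ((2 * (m - n)).+1 * j.+1 * 'C(n, j.+1)).
Proof.
move=> jm; elim: n => [|n IHn] nm; first by rewrite !big_ord0 bin0n !muln0.
rewrite !big_ord_recr /= IHn; last exact: ltnW.
have E := A_term_telescope jm (ltnW nm).
have [d def_m] : exists d, m = n + d.+1 by exists (m - n.+1); lia.
have W := A_weightS d n; rewrite -def_m in W.
have mn : m - n = d.+1 by lia.
have mn1 : m - n.+1 = d by lia.
have B := mul_bin_diag n.+1 j; rewrite /= in B.
rewrite mn in E *; rewrite mn1.
have -> : A_weight m n.+1 * ((2 * d).+1 * j.+1 * 'C(n.+1, j.+1)) =
    A_weight m n * (d.+1 * (m + n).+1 * 'C(n, j)).
  transitivity ((2 * d).+1 * A_weight m n.+1 * (j.+1 * 'C(n.+1, j.+1))); first by ring.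
  rewrite -B.
  transitivity ((2 * d).+1 * n.+1 * A_weight m n.+1 * 'C(n, j)); first by ring.
  by rewrite W; ring.
rewrite -!addnA; congr (_ + _).
by rewrite -!mulnDr -E; congr (_ * _); ring.
Qed.

Lemma A_sum_rec m j : j <= m ->
  (m - j) * (m + j).+1 * A_sum m j + j.+1 * j.+2 * A_sum m j.+2 =
  (2 * m).+1 * j.+1 * A_sum m j.+1.
Proof.
move=> jm.
transitivity (\sum_(k < m.+1) A_weight m k *
     ((m - j) * (m + j).+1 * 'C(k, j) + j.+1 * j.+2 * 'C(k, j.+2))).
  rewrite /A_sum !big_distrr -big_split; apply: eq_bigr => k _ /=; ring.
rewrite /A_sum big_distrr /=.
under [RHS]eq_bigr => k _ do rewrite mulnCA.
(* The last term k = m is split off; there the factor m-k kills what would be G_{m+1}. *)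
rewrite !big_ord_recr /= (A_partial_sum_rec jm (leqnn m)) -addnA; congr (_ + _).
have := A_term_telescope jm (leqnn m).
rewrite subnn mul0n mul0n addn0 => <-.
by rewrite -mulnDr; congr (_ * _); ring.
Qed.

Lemma A_sum_diag m : A_sum m m = 2 ^ m * 'C(2 * m, m).
Proof.
rewrite /A_sum big_ord_recr /= big1 => [|k _]; last by rewrite bin_small ?muln0.
by rewrite /A_weight !subnn bin0 binn !muln1 addnn mul2n.
Qed.

Lemma A_sum_gt m l : m < l -> A_sum m l = 0.
Proof.
move=> ml; rewrite /A_sum big1 // => k _.
by rewrite bin_small ?muln0 //; exact: leq_trans (ltn_ord k) ml.
Qed.

Lemma A_numerE l m : l <= m -> A_numer l m = l`! * m`! * A_sum m l.
Proof.
move=> lm; rewrite /A_numer; congr (_ * _).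
rewrite /A_sum -(big_mkord xpredT (fun k => A_weight m k * 'C(k, l))).
rewrite (@big_cat_nat _ _ _ l 0 m.+1) //=; last exact: leqW.
rewrite [X in _ = X + _]big1_seq // => k /=; rewrite mem_index_iota => /andP[_ kl].
by rewrite bin_small ?muln0.
Qed.

(** This is 2^m (m+l)! b_l, which stays in the naturals before b_l is known to be an integer. *)
Definition A_scaled (m l : nat) : nat := l`! * m`! * (m - l)`! * A_sum m l.

Lemma A_scaled_rec m j : j < m ->
  (m + j).+1 * A_scaled m j + (m - j.+1) * A_scaled m j.+2 =
  (2 * m).+1 * A_scaled m j.+1.
Proof.
move=> jm; have R := A_sum_rec (ltnW jm).
have F1 : (m - j)`! = (m - j) * (m - j.+1)`! by rewrite -(subnSK jm) factS.
have F2 : (m - j.+1) * ((m - j.+2)`! * A_sum m j.+2) = (m - j.+1)`! * A_sum m j.+2.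
  (* If j+1 = m, the factorial of m-(j+2) truncates to 0!, but S_{m+1} = 0. *)
  have [j2m|mj] := ltnP j.+1 m; last by rewrite A_sum_gt ?muln0.
  by rewrite mulnA -(subnSK j2m) factS.
rewrite /A_scaled F1.
transitivity (j`! * m`! * (m - j.+1)`! *
   ((m - j) * (m + j).+1 * A_sum m j + j.+1 * j.+2 * A_sum m j.+2)); last first.
  by rewrite R factS; ring.
rewrite (_ : (m - j.+1) * (j.+2`! * m`! * (m - j.+2)`! * A_sum m j.+2) =
   j.+2`! * m`! * ((m - j.+1) * ((m - j.+2)`! * A_sum m j.+2))); last by ring.
by rewrite F2 !factS; ring.
Qed.

Lemma A_scaled_odd_quotient m l : l <= m ->
  exists2 b, odd b & A_scaled m l = b * (2 ^ m * (m + l)`!).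
Proof.
pose Q l := exists2 b, odd b & A_scaled m l = b * (2 ^ m * (m + l)`!).
(* The recurrence has order two, so the induction on d = m-l carries two consecutive values. The
   guard [0 < d] excludes l = m+1, where [A_scaled] is 0 and no odd quotient exists. *)
suff H d : d <= m -> Q (m - d) /\ (0 < d -> Q (m - d).+1).
  by move=> lm; have [|] := H (m - l); [exact: leq_subr | rewrite subKn].
elim: d => [|d IHd] dm.
  split=> //; rewrite subn0; exists 1 => //.
  rewrite /A_scaled A_sum_diag subnn fact0 muln1 mul1n.
  have := @bin_fact (2 * m) m; rewrite (_ : 2 * m - m = m); last by lia.
  rewrite addnn -mul2n => <-; last by lia.
  by ring.
have [IH1 IH2] := IHd (ltnW dm); set j := m - d.+1.
have jS : m - d = j.+1 by rewrite /j; lia.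
have jm : j < m by rewrite /j; lia.
have mj : m - j.+1 = d by rewrite -jS; lia.
rewrite jS in IH1 IH2; split=> [|_ //].
have R := A_scaled_rec jm; rewrite mj in R.
have [b1 odd_b1 E1] := IH1.
(* For d = 0 the coefficient of b_{j+2} vanishes and any b2 serves. *)
have [b2 E2] : exists b2, d * A_scaled m j.+2 = d * (b2 * (2 ^ m * (m + j.+2)`!)).
  case: (posnP d) => [->|/IH2[b2 _ ->]]; first by exists 0; rewrite !mul0n.
  by exists b2.
rewrite E1 E2 !addnS !factS in R.
set K := 2 ^ m * (m + j)`!.
have K0 : 0 < K by rewrite muln_gt0 expn_gt0 fact_gt0.
have R' : A_scaled m j + K * (d * (m + j).+2 * b2) = K * ((2 * m).+1 * b1).
  apply/eqP; rewrite -(eqn_pmul2l (ltn0Sn (m + j))); apply/eqP.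
  transitivity ((2 * m).+1 * (b1 * (2 ^ m * ((m + j).+1 * (m + j)`!)))).
    by rewrite -R /K; ring.
  by rewrite /K; ring.
have le_b : d * (m + j).+2 * b2 <= (2 * m).+1 * b1.
  by rewrite -(leq_pmul2l K0) -R' leq_addl.
exists ((2 * m).+1 * b1 - d * (m + j).+2 * b2).
  have even_d : ~~ odd (d * (m + j).+2 * b2).
    have -> : (m + j).+2 = (d + 2 * j.+1).+1 by lia.
    by rewrite !oddM /= oddD oddM /= addbF andbN.
  by rewrite oddB // (negbTE even_d) oddM odd_b1 /= oddM.
by rewrite mulnC mulnBr -R' addnK.
Qed.

Lemma pochhammer_fact m l : l <= m ->
  pochhammer (m + 1 - l) (2 * l) * (m - l)`! = (m + l)`!.
Proof.
move=> lm; have fact_add a n : pochhammer a.+1 n * a`! = (a + n)`!.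
  elim: n => [|n IHn]; first by rewrite /pochhammer big_ord0 mul1n addn0.
  by rewrite /pochhammer big_ord_recr /= mulnAC IHn addnS factS addSn mulnC.
have -> : m + 1 - l = (m - l).+1 by lia.
by rewrite fact_add; congr (_`!); lia.
Qed.

Unset Implicit Arguments.

Theorem theorem1p1 (m l : nat) (hm : 1 <= m) (hl : l <= m) :
  logn 2 (A l m) = logn 2 (pochhammer (m + 1 - l) (2 * l)) + l.
Proof.
have [b odd_b E] := A_scaled_odd_quotient hl.
have P := pochhammer_fact hl.
have P0 : 0 < pochhammer (m + 1 - l) (2 * l).
  by have := fact_gt0 (m + l); rewrite -P muln_gt0 => /andP[].
have -> : A l m = b * (pochhammer (m + 1 - l) (2 * l) * 2 ^ l).
  (* The factor 2^(m-l) undoes the exact division in [A], and (m-l)! turns both sides into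
     [A_scaled m l]. *)
  apply/eqP; rewrite -(@eqn_pmul2r (2 ^ (m - l) * (m - l)`!)); last first.
    by rewrite muln_gt0 expn_gt0 fact_gt0.
  rewrite mulnA divnK ?dvdn_A_numer // A_numerE //; apply/eqP.
  transitivity (A_scaled m l); first by rewrite /A_scaled; ring.
  rewrite E -P -{1}(subnKC hl) expnD; ring.
rewrite lognM ?(odd_gt0 odd_b) ?muln_gt0 ?P0 ?expn_gt0 //.
rewrite lognM ?expn_gt0 // pfactorK //.
by rewrite (lognE 2 b) dvdn2 odd_b andbF.
Qed.
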